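(* Let $\mathcal{H}$ be a separable Hilbert space and let $\xi=\{\xi_n\}_{n\in\mathbb{N}}$ be a lower semi-frame of $\mathcal{H}$ with analysis operator $C_\xi$ and generalized frame operator $T_\xi$. Let $\mathcal{H}_\xi=\overline{\mathcal{D}(C_\xi)}$ and let $P$ be the orthogonal projection of $\mathcal{H}$ onto $\mathcal{H}_\xi$. Then $\{T_\xi^{-1}P\xi_n\}_{n\in\mathbb{N}}$ is a Bessel sequence of $\mathcal{H}$ and $$g=\sum_{n\in\mathbb{N}}\langle g,\xi_n\rangle\,T_\xi^{-1}P\xi_n,\qquad \forall g\in\mathcal{D}(C_\xi),$$ with unconditional convergence in $\mathcal{H}$.
   Context: Inner products $\langle\cdot,\cdot\rangle$ are linear in the first variable. A sequence $\xi=\{\xi_n\}_{n\in\mathbb{N}}$ in $\mathcal{H}$ is a lower semi-frame of $\mathcal{H}$ if there is $A>0$ with $A\|f\|^2\le\sum_{n}|\langle f,\xi_n\rangle|^2$ for all $f\in\mathcal{H}$ (the sum may be $+\infty$), and a Bessel sequence of $\mathcal{H}$ if there is $B>0$ with $\sum_n|\langle f,\xi_n\rangle|^2\le B\|f\|^2$ for all $f\in\mathcal{H}$. The domain $\mathcal{D}(C_\xi)$ is not assumed dense in $\mathcal{H}$. The analysis operator $C_\xi$ has domain $\mathcal{D}(C_\xi)=\{f\in\mathcal{H}:\sum_n|\langle f,\xi_n\rangle|^2<\infty\}$ and $C_\xi f=\{\langle f,\xi_n\rangle\}_n\in\ell^2(\mathbb{N})$. Let $\mathcal{H}_\xi=\overline{\mathcal{D}(C_\xi)}$,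 a Hilbert space with the inner product of $\mathcal{H}$. The generalized frame operator $T_\xi:\mathcal{D}(T_\xi)\subseteq\mathcal{H}_\xi\to\mathcal{H}_\xi$ is defined as follows: $\mathcal{D}(T_\xi)$ is the set of $f\in\mathcal{D}(C_\xi)$ for which there is $h\in\mathcal{H}_\xi$ with $\sum_n\langle f,\xi_n\rangle\langle\xi_n,g\rangle=\langle h,g\rangle$ for all $g\in\mathcal{D}(C_\xi)$, and then $T_\xi f=h$ (unique). $T_\xi$ is positive and self-adjoint in $\mathcal{H}_\xi$; when $\xi$ is a lower semi-frame, $T_\xi:\mathcal{D}(T_\xi)\to\mathcal{H}_\xi$ is bijective with bounded inverse $T_\xi^{-1}:\mathcal{H}_\xi\to\mathcal{H}_\xi$. *)

(* Defs.v *)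
From HB Require Import structures.
From mathcomp Require Import all_boot all_order all_algebra.
From mathcomp Require Import sesquilinear complex.
From mathcomp Require Import all_classical all_reals all_analysis.

Set Implicit Arguments.
Unset Strict Implicit.
Unset Printing Implicit Defensive.

Import Order.TTheory GRing.Theory Num.Theory Num.Def.
Import numFieldNormedType.Exports.
Local Open Scope classical_set_scope.
Local Open Scope ring_scope.
Local Open Scope complex_scope.

Definition separable (T : topologicalType) : Prop :=
  exists2 D : set T, countable D & dense D.

(* Every rearrangement of the series converges, with the same sum [s]. *)
Definition unconditionally_sums_to (K : numFieldType) (V : normedModType K)
    (u : nat -> V) (s : V) : Prop :=
  forall sigma : nat -> nat, bijective sigma ->
    series (u \o sigma) @ \oo --> s.

Section SemiFrames.
Context (R : realType) (H : completeNormedModType R[i]) (ip : {dot H for conjC}).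

(* Norms in a [normedModType R[i]] take values in [R[i]], with zero imaginary
   part; [complex.Re] reads them in [R]. *)
Definition sqnorm (f : H) : R := complex.Re `|f| ^+ 2.

Definition analysis_op (xi : nat -> H) (f : H) : nat -> R[i] :=
  fun n => ip f (xi n).

Definition sum_sq (c : nat -> R[i]) : \bar R :=
  (\sum_(0 <= n <oo) (complex.Re `|c n| ^+ 2)%:E)%E.

Definition lower_semi_frame (xi : nat -> H) : Prop :=
  exists2 A : R, 0 < A &
    forall f : H, ((A * sqnorm f)%:E <= sum_sq (analysis_op xi f))%E.

Definition bessel_sequence (xi : nat -> H) : Prop :=
  exists2 B : R, 0 < B &
    forall f : H, (sum_sq (analysis_op xi f) <= (B * sqnorm f)%:E)%E.

Definition analysis_dom (xi : nat -> H) : set H :=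
  [set f | (sum_sq (analysis_op xi f) < +oo)%E].

Definition Hspace (xi : nat -> H) : set H := closure (analysis_dom xi).

(* [R[i]^o] is [R[i]] with its topology as a normed space over itself. *)
Definition gframe_rel (xi : nat -> H) (f h : H) : Prop :=
  Hspace xi h /\
  forall g : H, analysis_dom xi g ->
    series (fun n => analysis_op xi f n * ip (xi n) g : R[i]^o) @ \oo
      --> (ip h g : R[i]^o).

Definition gframe_dom (xi : nat -> H) : set H :=
  [set f | analysis_dom xi f /\ exists h, gframe_rel xi f h].

(* The [h] in question is unique, as [analysis_dom xi] is dense in
   [Hspace xi]; [0] is a dummy for the case where there is none. *)
Definition gframe_op (xi : nat -> H) (f : H) : H :=
  xget 0 [set h | gframe_rel xi f h].

(* For a lower semi-frame [gframe_op xi] is a bijection from [gframe_dom xi]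
   onto [Hspace xi], so [0] is a dummy used only outside [Hspace xi]. *)
Definition gframe_inv (xi : nat -> H) (h : H) : H :=
  xget 0 [set f | gframe_dom xi f /\ gframe_op xi f = h].

(* The dummy [0] plays no role when [M] is a closed subspace. *)
Definition orth_proj (M : set H) (f : H) : H :=
  xget 0 [set p | M p /\ forall g, M g -> ip (f - p) g = 0].

End SemiFrames.

(* Main.v *)
Require Import Defs.
From HB Require Import structures.
From mathcomp Require Import all_boot all_order all_algebra.
From mathcomp Require Import sesquilinear complex.
From mathcomp Require Import all_classical all_reals all_analysis.
From mathcomp Require Import ring lra.
Import Order.TTheory GRing.Theory Num.Theory Num.Def.
Import numFieldNormedType.Exports.
Local Open Scope classical_set_scope.
Local Open Scope ring_scope.
Local Open Scope complex_scope.

(** Equip [D(C)] with the form [B(f, g) = sum_n <f, xi_n> <xi_n, g>].  It is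
    coercive by the lower frame bound and closed by Fatou, so for every [h] in
    [H] a Riesz argument gives [u] in [D(C)] with [B(u, g) = <h, g>] for all [g]
    in [D(C)]; this yields the inverse of [T].  Writing [eta_n] for the dual
    sequence, [B(eta_n, g) = <xi_n, g>], hence [<h, eta_n> = <u, xi_n>], and
    [sum_n |<u, xi_n>|^2 = B(u, u) = <h, u> <= |h|^2 / A] is the Bessel bound.
    Applying this to [h = g - sum_(n in F) <g, xi_n> eta_n] for a finite set [F],
    Cauchy-Schwarz gives [A |h|^2 <= sum_(n notin F) |<g, xi_n>|^2], which is
    insensitive to the order of summation. *)

(** * Complex scalars and norms read through real numbers *)

Section ComplexNorms.
Context {R : realType}.

Lemma ReD (x y : R[i]) : complex.Re (x + y) = complex.Re x + complex.Re y.
Proof. by case: x y => [a b] [c d]. Qed.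

Lemma ImD (a b : R[i]) : complex.Im (a + b) = complex.Im a + complex.Im b.
Proof. by case: a b => [a1 a2] [b1 b2]. Qed.

Lemma ReN (x : R[i]) : complex.Re (- x) = - complex.Re x.
Proof. by case: x. Qed.

Lemma ReJ (x : R[i]) : complex.Re (conjC x) = complex.Re x.
Proof. by case: x. Qed.

Lemma ReZ (t : R) (x : R[i]) : complex.Re (t%:C * x) = t * complex.Re x.
Proof. by case: x => a b /=; rewrite mul0r subr0. Qed.

Definition sqabs (z : R[i]) : R := complex.Re `|z| ^+ 2.

(** The real inner product of C seen as R^2; it is the polar form of [sqabs]. *)
Definition redot (a b : R[i]) : R := complex.Re (a * conjC b).

Lemma sqabs_ge0 (z : R[i]) : 0 <= sqabs z.
Proof. exact: sqr_ge0. Qed.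

Lemma sqabsE (z : R[i]) : sqabs z = complex.Re z ^+ 2 + complex.Im z ^+ 2.
Proof. by rewrite /sqabs normc_def /= sqr_sqrtr // addr_ge0 ?sqr_ge0. Qed.

Lemma sqabsD (a b : R[i]) (t : R) :
  sqabs (a + t%:C * b) = sqabs a + 2 * t * redot a b + t ^+ 2 * sqabs b.
Proof. by rewrite !sqabsE /redot; case: a b => [a1 a2] [b1 b2] /=; ring. Qed.

Lemma sqabsM (a b : R[i]) : sqabs (a * b) = sqabs a * sqabs b.
Proof. by rewrite !sqabsE; case: a b => [a1 a2] [b1 b2] /=; ring. Qed.

Lemma sqabsD_le (a b : R[i]) : sqabs (a + b) <= 2 * sqabs a + 2 * sqabs b.
Proof.
rewrite !sqabsE; case: a b => [a1 a2] [b1 b2] /=.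
by have := sqr_ge0 (a1 - b1); have := sqr_ge0 (a2 - b2); nra.
Qed.

Lemma redot_i (a b : R[i]) : redot ('i * a) b = - redot a ('i * b).
Proof. by rewrite /redot; case: a b => [a1 a2] [b1 b2] /=; ring. Qed.

Lemma Im_mul (a b : R[i]) : complex.Im (a * b) = complex.Re (a * (conjC 'i * b)).
Proof. by case: a b => [a1 a2] [b1 b2] /=; ring. Qed.

Lemma ler_Re_norm (z : R[i]) : `|complex.Re z| <= complex.Re `|z|.
Proof. by have := normc_ge_Re z; rewrite normc_def lecR. Qed.

(** Evaluation at the minimising [r] gives the discriminant bound behind both Cauchy-Schwarz
    inequalities and the Euler equation of the variational problem. *)
Lemma quad_disc (s x t : R) : 0 <= t ->
  (forall r : R, 0 <= s + 2 * r * x + r ^+ 2 * t) -> x ^+ 2 <= s * t.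
Proof.
move=> t0 E; have [t00|t00] := eqVneq t 0.
  have [->|x0] := eqVneq x 0; first by rewrite t00 mulr0 expr0n.
  (* With [t = 0] the expression is affine in [r]; at this point it equals -1, which excludes
     [x != 0]. *)
  have := E (- (s + 1) / (2 * x)).
  have -> : s + 2 * (- (s + 1) / (2 * x)) * x + (- (s + 1) / (2 * x)) ^+ 2 * t = -1.
    by rewrite t00 mulr0 addr0; field.
  by rewrite oppr_ge0 ler10.
have tp : 0 < t by rewrite lt_neqAle eq_sym t00.
have := E (- x / t).
have -> : s + 2 * (- x / t) * x + (- x / t) ^+ 2 * t = (s * t - x ^+ 2) / t.
  by field.
by rewrite pmulr_lge0 ?invr_gt0 // subr_ge0.
Qed.

Lemma sum_sqabsD (a b : nat -> R[i]) (t : R) (n : nat) :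
  \sum_(0 <= k < n) sqabs (a k + t%:C * b k) =
  \sum_(0 <= k < n) sqabs (a k) + 2 * t * (\sum_(0 <= k < n) redot (a k) (b k))
    + t ^+ 2 * (\sum_(0 <= k < n) sqabs (b k)).
Proof.
elim: n => [|n IHn]; first by rewrite !big_nil; ring.
by rewrite !big_nat_recr //= IHn sqabsD; ring.
Qed.

Lemma cauchy_schwarz_sum (a b : nat -> R[i]) (n : nat) :
  (\sum_(0 <= k < n) redot (a k) (b k)) ^+ 2 <=
  (\sum_(0 <= k < n) sqabs (a k)) * (\sum_(0 <= k < n) sqabs (b k)).
Proof.
apply: quad_disc => [|t]; first by apply: sumr_ge0 => k _; exact: sqabs_ge0.
by rewrite -sum_sqabsD; apply: sumr_ge0 => k _; exact: sqabs_ge0.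
Qed.

Context {V : normedModType R[i]}.

Lemma norm_real (f : V) : `|f| = (complex.Re `|f|)%:C.
Proof. by rewrite RRe_real // ger0_real. Qed.

Lemma Re_norm_ge0 (f : V) : 0 <= complex.Re `|f|.
Proof. by rewrite -ler0c -norm_real. Qed.

Lemma ler_Re_normD (f g : V) :
  complex.Re `|f + g| <= complex.Re `|f| + complex.Re `|g|.
Proof.
have := ler_normD f g.
by rewrite (norm_real (f + g)) (norm_real f) (norm_real g) -rmorphD lecR.
Qed.

Lemma cvg_Re_normP (u : nat -> V) (l : V) :
  u @ \oo --> l <->
  forall e : R, 0 < e -> \forall n \near \oo, complex.Re `|l - u n| < e.
Proof.
split=> [/cvgrPdist_lt ul e e0|ul].
  have := ul e%:C; rewrite ltcR => /(_ e0); apply: filterS => n.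
  by rewrite norm_real ltcR.
apply/cvgrPdist_lt => -[e e']; rewrite ltcE /= => /andP[/eqP -> e0].
by apply: filterS (ul e e0) => n; rewrite norm_real ltcR.
Qed.

Lemma cvg_sqr_Re_normP (u : nat -> V) (l : V) :
  (forall e : R, 0 < e -> \forall n \near \oo, complex.Re `|l - u n| ^+ 2 < e) ->
  u @ \oo --> l.
Proof.
move=> ul; apply/cvg_Re_normP => e e0.
have := ul (e ^+ 2); rewrite exprn_gt0 // => /(_ isT); apply: filterS => n.
by rewrite ltr_pXn2r // nnegrE ?Re_norm_ge0 // ltW.
Qed.

End ComplexNorms.

Lemma cvg_complexP (R : realType) (u : nat -> R[i]) (l : R[i]) :
  (u : nat -> R[i]^o) @ \oo --> (l : R[i]^o) <->
  ((fun n => complex.Re (u n)) @ \oo --> complex.Re l) /\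
  ((fun n => complex.Im (u n)) @ \oo --> complex.Im l).
Proof.
split=> [/cvg_Re_normP ul|[/cvgrPdist_lt ur /cvgrPdist_lt ui]].
  have hR (z : R[i]) : `|complex.Re z| <= complex.Re `|z : R[i]^o|.
    exact: ler_Re_norm.
  have hI (z : R[i]) : `|complex.Im z| <= complex.Re `|z : R[i]^o|.
    rewrite normc_def /= -[X in X <= _]sqrtr_sqr.
    by rewrite ler_sqrt ?addr_ge0 ?sqr_ge0 // lerDr sqr_ge0.
  split; apply/cvgrPdist_lt => e e0; apply: filterS (ul e e0) => n.
    by apply: le_lt_trans; have := hR (l - u n); rewrite ReD ReN.
  by apply: le_lt_trans; have := hI (l - u n); case: (l) (u n) => [? ?] [].
apply: (@cvg_sqr_Re_normP _ R[i]^o) => e e0.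
have [s s0 s2] : exists2 s : R, 0 < s & s ^+ 2 = e / 2.
  exists (Num.sqrt (e / 2)); first by rewrite sqrtr_gt0 divr_gt0.
  by rewrite sqr_sqrtr // ltW // divr_gt0.
near=> n.
suff : sqabs (l - u n) < e by [].
have : `|complex.Re l - complex.Re (u n)| < s by near: n; exact: ur.
have : `|complex.Im l - complex.Im (u n)| < s by near: n; exact: ui.
rewrite sqabsE !ltr_norml => /andP[H1 H2] /andP[H3 H4].
have : (complex.Re l - complex.Re (u n)) ^+ 2 < e / 2 by rewrite -s2; nra.
have : (complex.Im l - complex.Im (u n)) ^+ 2 < e / 2 by rewrite -s2; nra.
case: (l) (u n) => [a b] [c d] /=; lra.
Unshelve. all: by end_near.
Qed.

(** * The real inner product and a variational Riesz argument *)

Section RealInnerProduct.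
Context {R : realType} {H : completeNormedModType R[i]} (ip : {dot H for conjC}).
Hypothesis ip_norm : forall f : H, ip f f = `|f| ^+ 2.

Lemma ipC (f g : H) : ip f g = conjC (ip g f).
Proof. by rewrite hermC expr0 mul1r. Qed.

Definition real_ip (f g : H) : R := complex.Re (ip f g).

Local Notation rip := real_ip.

Lemma ripC (f g : H) : rip f g = rip g f.
Proof. by rewrite /real_ip ipC ReJ. Qed.

Lemma ripDl (f g h : H) : rip (f + g) h = rip f h + rip g h.
Proof. by rewrite /real_ip linearDl ReD. Qed.

Lemma ripZl (t : R) (f g : H) : rip (t%:C *: f) g = t * rip f g.
Proof. by rewrite /real_ip linearZl_LR ReZ. Qed.

Lemma ripNl (f g : H) : rip (- f) g = - rip f g.
Proof. by rewrite /real_ip linearNl ReN. Qed.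

Lemma ripDr (f g h : H) : rip h (f + g) = rip h f + rip h g.
Proof. by rewrite !(ripC h) ripDl. Qed.

Lemma ripZr (t : R) (f g : H) : rip g (t%:C *: f) = t * rip g f.
Proof. by rewrite !(ripC g) ripZl. Qed.

Lemma rip_sqnorm (f : H) : rip f f = sqnorm f.
Proof. by rewrite /real_ip /sqnorm ip_norm norm_real -rmorphXn. Qed.

(** Conjugate linearity turns ['i] into [-'i], so real parts on a complex subspace determine the
    whole inner product. *)
Lemma Im_ip (f g : H) : complex.Im (ip f g) = rip f ('i *: g).
Proof.
rewrite /real_ip linearZr_LR /=; case: (ip f g) => a b /=.
by rewrite mul0r mulN1r opprK add0r.
Qed.

Lemma sqnorm_ge0 (f : H) : 0 <= sqnorm f.
Proof. exact: sqr_ge0. Qed.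

Lemma sqnormD (f g : H) (t : R) :
  sqnorm (f + t%:C *: g) = sqnorm f + 2 * t * rip f g + t ^+ 2 * sqnorm g.
Proof.
by rewrite -!rip_sqnorm !ripDl !ripDr !ripZl !ripZr (ripC g f); ring.
Qed.

Lemma sqr_rip_le (f g : H) : rip f g ^+ 2 <= sqnorm f * sqnorm g.
Proof.
by apply: quad_disc => [|t]; rewrite -?sqnormD sqnorm_ge0.
Qed.

(** Young's inequality, from expanding the squared norm of [f - e g] and dividing by [e]. *)
Lemma rip_le (f g : H) (e : R) : 0 < e ->
  2 * rip f g <= sqnorm f / e + e * sqnorm g.
Proof.
move=> e0; have := sqnorm_ge0 (f + (- e)%:C *: g).
rewrite sqnormD => h.
have -> : sqnorm f / e + e * sqnorm g =
    (sqnorm f + 2 * - e * rip f g + (- e) ^+ 2 * sqnorm g) / e + 2 * rip f g.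
  by field; rewrite gt_eqF.
by rewrite lerDr divr_ge0 // ltW.
Qed.

Lemma cvg_rip (u : nat -> H) (l h : H) :
  u @ \oo --> l -> (fun n => rip h (u n)) @ \oo --> rip h l.
Proof.
move=> /cvg_Re_normP ul; apply/cvgrPdist_lt => e e0.
(* Adding 1 keeps the divisor positive when [h = 0]. *)
set c := complex.Re `|h| + 1.
have c0 : 0 < c by rewrite ltr_wpDl // Re_norm_ge0.
have := ul (e / c); rewrite divr_gt0 // => /(_ isT); apply: filterS => n un.
have -> : rip h l - rip h (u n) = rip h (l - u n).
  by rewrite ripDr !(ripC h) ripNl.
have : `|rip h (l - u n)| <= complex.Re `|h| * complex.Re `|l - u n|.
  rewrite -(@ler_pXn2r _ 2) ?nnegrE ?mulr_ge0 ?Re_norm_ge0 //.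
  by rewrite real_normK ?num_real // exprMn sqr_rip_le.
move/le_lt_trans; apply.
apply: (@le_lt_trans _ _ (c * complex.Re `|l - u n|)).
  by rewrite ler_wpM2r ?Re_norm_ge0 // /c lerDl.
by rewrite mulrC -ltr_pdivlMr.
Qed.

(* The minimiser of [q f - 2 rip h f]: the parallelogram identity makes a
   minimising sequence Cauchy for [q], hence in norm by coercivity, and lower
   semicontinuity passes the bound to the limit. *)
Lemma coercive_representation (M : set H) (q : H -> R) (b : H -> H -> R)
    (A : R) (h : H) :
  M 0 -> (forall f g t, M f -> M g -> M (f + t%:C *: g)) ->
  (forall f g t, M f -> M g ->
     q (f + t%:C *: g) = q f + 2 * t * b f g + t ^+ 2 * q g) ->
  0 < A -> (forall f, M f -> A * sqnorm f <= q f) ->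
  (forall (u : nat -> H) (c : nat -> R) (f : H) (l : R),
     (forall n, M (u n)) -> u @ \oo --> f ->
     (forall n, q (u n) <= c n) -> c @ \oo --> l -> M f /\ q f <= l) ->
  exists2 f, M f & forall g, M g -> b f g = rip h g.
Proof.
move=> M0 Mlin qD A0 qA qlsc.
pose J f := q f - 2 * rip h f.
pose E := [set J f | f in M].
have Jlb f : M f -> - (sqnorm h / A) <= J f.
  move=> Mf; have := rip_le h f A A0; have := qA _ Mf; rewrite /J; lra.
have lbE : has_lbound E.
  by exists (- (sqnorm h / A)) => _ [f Mf <-]; exact: Jlb.
have infE : has_inf E by split => //; exists (J 0); exists 0.
set m := inf E.
have mJ f : M f -> m <= J f by move=> Mf; apply: ge_inf => //; exists f.
have /choice [u uP] : forall n : nat, exists f, M f /\ J f < m + n.+1%:R^-1.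
  move=> n; have n0 : 0 < n.+1%:R^-1 :> R by rewrite invr_gt0.
  by have [_ [f Mf <-] Jf] := inf_adherent n0 infE; exists f.
have uM n : M (u n) by case: (uP n).
have uJ n : J (u n) < m + n.+1%:R^-1 by case: (uP n).
(* Parallelogram identity: the midpoint [g + (f - g) / 2] lies in [M], so its [J] is at least
   [m]. *)
have par f g : M f -> M g -> A * sqnorm (f - g) <= 2 * (J f - m) + 2 * (J g - m).
  move=> Mf Mg.
  have Mfg : M (f - g).
    by have := Mlin f g (-1) Mf Mg; rewrite rmorphN rmorph1 scaleN1r.
  have := qA _ Mfg; move/le_trans; apply.
  have := mJ _ (Mlin g (f - g) 2^-1 Mg Mfg).
  have := qD g (f - g) 1 Mg Mfg; rewrite rmorph1 scale1r addrC subrK.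
  rewrite /J qD // !ripDr ripZr ripDr (ripC h (- g)) ripNl (ripC g h).
  by move: (q f) (q g) (q (f - g)) (b g (f - g)) (rip h f) (rip h g) => *; lra.
have ucauchy : cauchy (u @ \oo).
  apply: cauchy_exP => -[e e']; rewrite ltcE /= => /andP[/eqP -> e0].
  have e20 : 0 < A * e ^+ 2 by rewrite mulr_gt0 // exprn_gt0.
  (* The 4 comes from two excesses over [m], each below [1/(N+1)] and carrying the factor 2 of
     [par]. *)
  have [N _ tail] : \forall n \near \oo, 4 * n.+1%:R^-1 < A * e ^+ 2.
    have /cvgrPdist_lt/(_ (A * e ^+ 2 / 4)) := @cvg_harmonic R.
    rewrite divr_gt0 // => /(_ isT); apply: filterS => n.
    rewrite /harmonic /= sub0r normrN ger0_norm ?invr_ge0 // ltr_pdivlMr //.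
    by rewrite mulrC.
  exists (u N); exists N => // n /= Nn.
  rewrite -ball_normE /ball_ /= norm_real ltcR.
  rewrite -(@ltr_pXn2r _ 2) ?nnegrE ?Re_norm_ge0 ?(ltW e0) //.
  have : A * sqnorm (u N - u n) < A * e ^+ 2.
    apply: le_lt_trans (tail N (leqnn N)).
    apply: le_trans (par _ _ (uM N) (uM n)) _.
    have := uJ N; have := uJ n.
    have : n.+1%:R^-1 <= N.+1%:R^-1 :> R by rewrite lef_pV2 ?posrE // ler_nat.
    by move: (n.+1%:R^-1) (N.+1%:R^-1) (J (u n)) (J (u N)) => *; lra.
  by rewrite ltr_pM2l.
have /cauchy_cvg ul := ucauchy; set l := lim _ in ul.
(* Solving [J (u n) < m + 1/(n+1)] for [q (u n)] gives this bound; its limit yields [J l <= m]. *)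
have cl : (fun n => m + n.+1%:R^-1 + 2 * rip h (u n)) @ \oo --> m + 0 + 2 * rip h l.
  apply: cvgD; last by apply: cvgMr; exact: cvg_rip.
  by apply: cvgD; [exact: cvg_cst|exact: cvg_harmonic].
have [n|Ml ql] := qlsc u _ l _ uM ul _ cl.
  have := uJ n; rewrite /J.
  by move: (q (u n)) (rip h (u n)) (n.+1%:R^-1) => *; lra.
exists l => // g Mg; apply/eqP; rewrite -subr_eq0 -sqrf_eq0.
have qg0 : 0 <= q g by apply: le_trans (qA _ Mg); rewrite mulr_ge0 ?sqnorm_ge0 ?ltW.
(* As [J l <= m], minimality along [l + t g] gives a nonnegative quadratic in [t] with zero constant
   term, so its linear coefficient vanishes. *)
have : (b l g - rip h g) ^+ 2 <= 0 * q g.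
  apply: quad_disc => // t; have := mJ _ (Mlin l g t Ml Mg).
  by rewrite /J qD // ripDr ripZr; lra.
by rewrite mul0r eq_le sqr_ge0 andbT.
Qed.
End RealInnerProduct.

Lemma cvgn_uniq {R : realType} (u : nat -> R) (a b : R) :
  u @ \oo --> a -> u @ \oo --> b -> a = b.
Proof. by move=> ua ub; rewrite -(cvg_lim _ ua) // (cvg_lim _ ub). Qed.

(** * Extended-real square sums and their finite values *)

Section SumSq.
Context {R : realType}.
Implicit Types c : nat -> R[i].

Lemma sum_sqabs_EFin c n :
  (\sum_(0 <= k < n) (complex.Re `|c k| ^+ 2)%:E)%E =
  (\sum_(0 <= k < n) sqabs (c k))%:E.
Proof. exact: sumEFin. Qed.

Lemma sum_sq_cvg c :
  (fun n => (\sum_(0 <= k < n) sqabs (c k))%:E) @ \oo --> sum_sq c.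
Proof.
rewrite (_ : (fun n => _) =
    fun n => (\sum_(0 <= k < n) (complex.Re `|c k| ^+ 2)%:E)%E).
  by apply: is_cvg_nneseries => k _ _; rewrite lee_fin sqr_ge0.
by apply/funext => n; rewrite sum_sqabs_EFin.
Qed.

Lemma sum_sq_le c (l : R) :
  (forall n, \sum_(0 <= k < n) sqabs (c k) <= l) -> (sum_sq c <= l%:E)%E.
Proof.
move=> cl; have cv := @sum_sq_cvg c.
rewrite -(cvg_lim _ cv) //; apply: lime_le; first by apply/cvg_ex; exists (sum_sq c).
by apply: nearW => n; rewrite lee_fin.
Qed.

Lemma sum_sq_fineK c : (sum_sq c < +oo)%E -> sum_sq c = (fine (sum_sq c))%:E.
Proof.
move=> coo; rewrite fineK // ge0_fin_numE //.
by apply: nneseries_ge0 => k _ _; rewrite lee_fin sqr_ge0.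
Qed.

Lemma sum_sqabs_le_fine c n : (sum_sq c < +oo)%E ->
  \sum_(0 <= k < n) sqabs (c k) <= fine (sum_sq c).
Proof.
move=> /sum_sq_fineK cE; rewrite -lee_fin -cE -sum_sqabs_EFin.
by apply: nneseries_lim_ge => k _ _; rewrite lee_fin sqr_ge0.
Qed.

Lemma cvg_sum_sqabs c : (sum_sq c < +oo)%E ->
  (fun n => \sum_(0 <= k < n) sqabs (c k)) @ \oo --> fine (sum_sq c).
Proof.
move=> /sum_sq_fineK cE; have := @sum_sq_cvg c; rewrite {1}cE.
by move/fine_cvg.
Qed.

End SumSq.

(** * The form B on the domain of the analysis operator *)

Section AnalysisForm.
Context {R : realType} {H : completeNormedModType R[i]} (ip : {dot H for conjC}).
Hypothesis ip_norm : forall f : H, ip f f = `|f| ^+ 2.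
Variable xi : nat -> H.

Local Notation rip := (real_ip ip).
Local Notation D := (analysis_dom ip xi).
Local Notation C := (analysis_op ip xi).

(** [fine] sends [+oo] to 0, so this is B(f, f) only for [f] in [D(C)]. *)
Definition qform (f : H) : R := fine (sum_sq (C f)).

(* The real part of the sesquilinear form [sum_n <f, xi_n> <xi_n, g>], obtained
   by polarisation so that no summability has to be established separately. *)
Definition bform (f g : H) : R := (qform (f + g) - qform f - qform g) / 2.

Lemma analysis_opD (f g : H) (c : R[i]) n : C (f + c *: g) n = C f n + c * C g n.
Proof. by rewrite /analysis_op linearDl linearZl_LR. Qed.

Lemma analysis_dom_lin (f g : H) (c : R[i]) : D f -> D g -> D (f + c *: g).
Proof.
move=> Df Dg; rewrite /analysis_dom /=.
apply: (@le_lt_trans _ _ (2 * qform f + 2 * (sqabs c * qform g))%:E);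
  last exact: ltry.
apply: sum_sq_le => n.
apply: (@le_trans _ _ (\sum_(0 <= k < n)
    (2 * sqabs (C f k) + 2 * (sqabs c * sqabs (C g k))))).
  by apply: ler_sum => k _; rewrite analysis_opD -sqabsM sqabsD_le.
rewrite big_split /= -!mulr_sumr lerD // ler_pM2l ?sum_sqabs_le_fine //.
by rewrite ler_wpM2l ?sqabs_ge0 ?sum_sqabs_le_fine.
Qed.

Lemma analysis_dom0 : D 0.
Proof.
rewrite /analysis_dom /=; apply: (@le_lt_trans _ _ 0%:E); last exact: ltry.
apply: sum_sq_le => n; rewrite big1 // => k _.
by rewrite /analysis_op linear0l sqabsE /= expr0n addr0.
Qed.

Lemma analysis_domZ (f : H) (c : R[i]) : D f -> D (c *: f).
Proof.
by move=> Df; rewrite -[c *: f]add0r; exact: analysis_dom_lin analysis_dom0 Df.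
Qed.

Lemma analysis_domD (f g : H) : D f -> D g -> D (f + g).
Proof. by move=> Df Dg; rewrite -[g]scale1r; exact: analysis_dom_lin. Qed.

Lemma cvg_qform (f : H) : D f ->
  (fun n => \sum_(0 <= k < n) sqabs (C f k)) @ \oo --> qform f.
Proof. exact: cvg_sum_sqabs. Qed.

(** Polarisation holds for partial sums and passes to the limit, so [bform] is the sum of the real
    parts of the series for B. *)
Lemma cvg_bform (f g : H) : D f -> D g ->
  (fun n => \sum_(0 <= k < n) redot (C f k) (C g k)) @ \oo --> bform f g.
Proof.
move=> Df Dg.
have -> : (fun n => \sum_(0 <= k < n) redot (C f k) (C g k)) = fun n =>
    (\sum_(0 <= k < n) sqabs (C (f + g) k) - \sum_(0 <= k < n) sqabs (C f k)
     - \sum_(0 <= k < n) sqabs (C g k)) / 2.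
  apply/funext => n.
  have -> : \sum_(0 <= k < n) sqabs (C (f + g) k) =
      \sum_(0 <= k < n) sqabs (C f k + 1%:C * C g k).
    by apply: eq_bigr => k _; rewrite -analysis_opD scale1r.
  by rewrite sum_sqabsD; field.
apply: cvgMl; apply: cvgB; last exact: cvg_qform.
by apply: cvgB; apply: cvg_qform => //; exact: analysis_domD.
Qed.

Lemma qformD (f g : H) (t : R) : D f -> D g ->
  qform (f + t%:C *: g) = qform f + 2 * t * bform f g + t ^+ 2 * qform g.
Proof.
move=> Df Dg; apply: cvgn_uniq (cvg_qform _ (analysis_dom_lin _ _ _ Df Dg)) _.
have -> : (fun n => \sum_(0 <= k < n) sqabs (C (f + t%:C *: g) k)) = fun n =>
    \sum_(0 <= k < n) sqabs (C f k) +
    2 * t * (\sum_(0 <= k < n) redot (C f k) (C g k))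
    + t ^+ 2 * (\sum_(0 <= k < n) sqabs (C g k)).
  apply/funext => n; rewrite -sum_sqabsD.
  by apply: eq_bigr => k _; rewrite analysis_opD.
apply: cvgD; last by apply: cvgMr; exact: cvg_qform.
by apply: cvgD; [exact: cvg_qform|apply: cvgMr; exact: cvg_bform].
Qed.

Lemma bformC (f g : H) : bform f g = bform g f.
Proof. by rewrite /bform (addrC f g) addrAC. Qed.

Lemma bform_diag (f : H) : D f -> bform f f = qform f.
Proof.
move=> Df; apply: cvgn_uniq (cvg_bform _ _ Df Df) _.
have -> : (fun n => \sum_(0 <= k < n) redot (C f k) (C f k)) =
    fun n => \sum_(0 <= k < n) sqabs (C f k).
  apply/funext => n; apply: eq_bigr => k _; rewrite sqabsE /redot.
  by case: (C f k) => a b /=; ring.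
exact: cvg_qform.
Qed.

Lemma bform_i (f g : H) : D f -> D g -> bform ('i *: f) g = - bform f ('i *: g).
Proof.
move=> Df Dg.
apply: cvgn_uniq (cvg_bform _ _ (analysis_domZ _ _ Df) Dg) _.
have -> : (fun n => \sum_(0 <= k < n) redot (C ('i *: f) k) (C g k)) =
    fun n => - \sum_(0 <= k < n) redot (C f k) (C ('i *: g) k).
  apply/funext => n; rewrite -sumrN; apply: eq_bigr => k _.
  by rewrite /analysis_op !linearZl_LR redot_i.
by apply: cvgN; apply: cvg_bform => //; exact: analysis_domZ.
Qed.

Lemma sqabs_ip (f g : H) : sqabs (ip f g) = rip g f ^+ 2 + rip ('i *: g) f ^+ 2.
Proof. by rewrite sqabsE Im_ip !(ripC _ _ f). Qed.

(** Fatou's argument: each finite sum of squared coefficients is continuous in norm, so the bounds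
    pass to the limit in [n] before the number of terms grows. *)
Lemma qform_lsc (u : nat -> H) (c : nat -> R) (f : H) (l : R) :
  (forall n, D (u n)) -> u @ \oo --> f ->
  (forall n, qform (u n) <= c n) -> c @ \oo --> l -> D f /\ qform f <= l.
Proof.
move=> Du uf qc cl.
have le_l : (sum_sq (C f) <= l%:E)%E.
  apply: sum_sq_le => N.
  have cvN : (fun n => \sum_(0 <= k < N) sqabs (C (u n) k)) @ \oo -->
      \sum_(0 <= k < N) sqabs (C f k).
    elim: N => [|N IHN].
      under eq_fun do rewrite big_nil; rewrite big_nil; exact: cvg_cst.
    under eq_fun do rewrite big_nat_recr //=.
    rewrite big_nat_recr //=; apply: cvgD => //.
    under eq_fun do rewrite /analysis_op sqabs_ip.
    rewrite /analysis_op sqabs_ip.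
    by apply: cvgD; rewrite expr2; apply: cvgM; exact: cvg_rip.
  apply: ler_cvg_to cvN cl _; apply: nearW => n.
  exact: le_trans (sum_sqabs_le_fine _ _ (Du n)) (qc n).
have Df : D f by exact: le_lt_trans le_l (ltry _).
by split => //; rewrite -lee_fin /qform -sum_sq_fineK.
Qed.

Lemma analysis_representation (A : R) (h : H) : 0 < A ->
  (forall f : H, ((A * sqnorm f)%:E <= sum_sq (C f))%E) ->
  exists2 f, D f & forall g, D g -> bform f g = rip h g.
Proof.
move=> A0 xiA.
apply: (@coercive_representation _ _ _ ip_norm D qform bform A h) => //.
- exact: analysis_dom0.
- by move=> f g t; exact: analysis_dom_lin.
- by move=> f g t; exact: qformD.
- by move=> f Df; rewrite -lee_fin /qform -sum_sq_fineK.
- exact: qform_lsc.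
Qed.

Lemma Re_pairing (f g : H) n :
  complex.Re (series (fun n => C f n * ip (xi n) g : R[i]^o) n) =
  \sum_(0 <= k < n) redot (C f k) (C g k).
Proof.
elim: n => [|n IHn]; first by rewrite /series /= !big_nil.
rewrite /series /= !big_nat_recr //= ReD IHn; congr (_ + _).
by rewrite /redot ipC.
Qed.

Lemma Im_pairing (f g : H) n :
  complex.Im (series (fun n => C f n * ip (xi n) g : R[i]^o) n) =
  \sum_(0 <= k < n) redot (C f k) (C ('i *: g) k).
Proof.
rewrite -(Re_pairing f ('i *: g)); elim: n => [|n IHn].
  by rewrite /series /= !big_nil.
rewrite /series /= !big_nat_recr //= ReD -IHn linearZr_LR /= -Im_mul.
exact: ImD.
Qed.

(** The real identity at [g] gives the real part of the series, and at ['i *: g] its imaginary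
    part. *)
Lemma gframe_pairing (f h : H) : D f ->
  (forall g, D g -> bform f g = rip h g) ->
  forall g, D g -> series (fun n => C f n * ip (xi n) g : R[i]^o) @ \oo
      --> (ip h g : R[i]^o).
Proof.
move=> Df fh g Dg; apply/cvg_complexP; split.
  under eq_fun do rewrite Re_pairing.
  by have := cvg_bform _ _ Df Dg; rewrite fh.
under eq_fun do rewrite Im_pairing.
rewrite Im_ip; have Dig := analysis_domZ _ 'i Dg.
by have := cvg_bform _ _ Df Dig; rewrite fh.
Qed.

Lemma bform_gframe (f h g : H) : D f -> gframe_rel ip xi f h -> D g ->
  bform f g = rip h g.
Proof.
move=> Df [_ /(_ g) + ] Dg => /(_ Dg)/cvg_complexP[+ _].
under eq_fun do rewrite Re_pairing.
exact: cvgn_uniq (cvg_bform _ _ Df Dg).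
Qed.
End AnalysisForm.

(** * Closures and reindexed finite sums *)

Lemma closure_normP {R : realType} {V : normedModType R[i]} (E : set V) (f : V) :
  closure E f <->
  forall e : R, 0 < e -> exists2 d, E d & complex.Re `|f - d| < e.
Proof.
split=> [Ef e e0|Ef B].
  have e0' : 0 < e%:C :> R[i] by rewrite ltcR.
  have [d [Ed]] := Ef _ (nbhsx_ballx f e%:C e0').
  by rewrite -ball_normE /ball_ /= norm_real ltcR => fd; exists d.
move=> /nbhs_ballP[[e e']] /=; rewrite ltcE /= => /andP[/eqP -> e0] eB.
have [d Ed fd] := Ef e e0; exists d; split => //; apply: eB.
by rewrite -ball_normE /ball_ /= norm_real ltcR.
Qed.

(** Injectivity leaves no repetition among the values of [s], so a rearranged partial sum selects
    terms of an initial segment. *)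
Lemma sum_image {V : nmodType} (G : nat -> V) (s : nat -> nat) (N n : nat) :
  injective s -> (forall j, (j < N)%N -> (s j < n)%N) ->
  \sum_(0 <= j < N) G (s j) =
  \sum_(0 <= k < n | k \in [seq s j | j <- index_iota 0 N]) G k.
Proof.
move=> s_inj sn; rewrite -[RHS]big_filter -(big_map s predT G) /=.
apply: perm_big; apply: uniq_perm => [||k].
- by rewrite map_inj_uniq ?iota_uniq.
- by rewrite filter_uniq ?iota_uniq.
rewrite mem_filter; case: mapP => //= -[j + ->].
by rewrite !mem_index_iota => /sn.
Qed.

Lemma ex_bound (F : nat -> nat) (N : nat) :
  exists n, forall j, (j < N)%N -> (F j < n)%N.
Proof.
exists (\max_(j < N) F j).+1 => j jN.
by rewrite ltnS (leq_bigmax (Ordinal jN)).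
Qed.

(** * The closed subspace [Hspace] and its orthogonal projection *)

Section DualSequence.
Context {R : realType} {H : completeNormedModType R[i]} (ip : {dot H for conjC}).
Hypothesis ip_norm : forall f : H, ip f f = `|f| ^+ 2.
Variable xi : nat -> H.

Local Notation rip := (real_ip ip).
Local Notation D := (analysis_dom ip xi).
Local Notation C := (analysis_op ip xi).
Local Notation M := (Hspace ip xi).

Lemma Hspace_lin (f g : H) (c : R[i]) : M f -> M g -> M (f + c *: g).
Proof.
move=> /closure_normP Mf /closure_normP Mg; apply/closure_normP => e e0.
set s := complex.Re `|c| + 1.
have s0 : 0 < s by rewrite ltr_wpDl // (@Re_norm_ge0 _ R[i]^o).
have [|d1 Dd1 fd1] := Mf (e / 2); first by rewrite divr_gt0.
have [|d2 Dd2 gd2] := Mg (e / 2 / s); first by rewrite !divr_gt0.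
exists (d1 + c *: d2); first exact: analysis_dom_lin.
have -> : f + c *: g - (d1 + c *: d2) = (f - d1) + c *: (g - d2).
  by rewrite opprD scalerBr addrACA.
apply: le_lt_trans (ler_Re_normD _ _) _.
have -> : complex.Re `|c *: (g - d2)| = complex.Re `|c| * complex.Re `|g - d2|.
  by rewrite normrZ (norm_real (g - d2)) (norm_real (c : R[i]^o)) -rmorphM.
have : complex.Re `|c| * complex.Re `|g - d2| <= s * complex.Re `|g - d2|.
  by rewrite ler_wpM2r ?Re_norm_ge0 // lerDl.
have : s * complex.Re `|g - d2| < e / 2 by rewrite mulrC -ltr_pdivlMr.
by move: fd1; move: (complex.Re `|f - d1|) (complex.Re `|c| * _) (s * _) => *; lra.
Qed.

Lemma analysis_dom_Hspace (f : H) : D f -> M f.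
Proof. exact: subset_closure. Qed.

Lemma Hspace_orth_eq0 (d : H) : M d -> (forall g, D g -> rip d g = 0) -> d = 0.
Proof.
move=> /closure_normP Md dD.
suff d0 : sqnorm d <= 0.
  apply/eqP; rewrite -normr_eq0 norm_real.
  suff -> : complex.Re `|d| = 0 by [].
  by apply/eqP; rewrite -sqrf_eq0 eq_le d0 sqr_ge0.
apply/ler_addgt0Pl => e e0; rewrite addr0.
have [|g Dg dg] := Md (Num.sqrt e); first by rewrite sqrtr_gt0.
have dg2 : sqnorm (d - g) <= e.
  rewrite /sqnorm -[leRHS]sqr_sqrtr ?(ltW e0) //.
  by rewrite ler_pXn2r ?nnegrE ?Re_norm_ge0 ?sqrtr_ge0 // ltW.
(* [d] is orthogonal to [g], so [rip d (d - g)] is [sqnorm d], and Young's inequality with weight 1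
   gives [sqnorm d <= sqnorm (d - g)]. *)
have := rip_le _ ip_norm d (d - g) 1 ltr01.
rewrite ripDr (ripC _ _ (- g)) ripNl (ripC _ g) (dD g) // rip_sqnorm //.
by move: (sqnorm d) (sqnorm (d - g)) dg2 => *; lra.
Qed.

Lemma orth_projP (f : H) :
  M (orth_proj ip M f) /\ forall g, M g -> ip (f - orth_proj ip M f) g = 0.
Proof.
suff [p Mp pf] : exists2 p, M p & forall g, M g -> rip p g = rip f g.
  apply: (@xgetPex _ 0 [set p | M p /\ forall g, M g -> ip (f - p) g = 0]).
  exists p; split=> // g Mg; apply/eqP; rewrite eq_complex Im_ip.
  have Mig : M ('i *: g).
    rewrite -[_ *: _]add0r; apply: Hspace_lin => //.
    by apply: analysis_dom_Hspace; exact: analysis_dom0.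
  by rewrite -/(real_ip _ _ _) !ripDl !ripNl !pf // !subrr eqxx.
(* The projection is the Riesz representative of [f] on [M] for the squared norm itself, with
   coercivity constant 1. *)
apply: (@coercive_representation _ _ _ ip_norm M (@sqnorm _ _) rip 1 f) => //.
- by apply: analysis_dom_Hspace; exact: analysis_dom0.
- by move=> g h t; exact: Hspace_lin.
- by move=> g h t _ _; exact: sqnormD.
- by move=> g _; rewrite mul1r.
move=> u c g l Mu ug uc cl; split.
  apply: (closed_cvg M _ _ _ ug); first exact: closed_closure.
  exact: nearW.
have c1 : (fun n => 2 * rip g (u n)) @ \oo --> 2 * rip g g.
  by apply: cvgMr; exact: cvg_rip.
have c2 : (fun n => sqnorm g + c n) @ \oo --> sqnorm g + l.
  by apply: cvgD => //; exact: cvg_cst.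
(* Young's inequality for [g] and [u n] passes to the limit and gives lower semicontinuity of the
   norm. *)
suff : 2 * rip g g <= sqnorm g + l by rewrite rip_sqnorm //; lra.
apply: ler_cvg_to c1 c2 _; apply: nearW => n.
have := rip_le _ ip_norm g (u n) 1 ltr01; have := uc n.
by move: (sqnorm (u n)) (c n) (sqnorm g) (rip g (u n)) => *; lra.
Qed.

(** The difference lies in [Hspace] and is orthogonal to the dense subspace [D(C)]; hence the choice
    made in [gframe_op] is forced. *)
Lemma gframe_rel_uniq (f h h' : H) : D f ->
  gframe_rel ip xi f h -> gframe_rel ip xi f h' -> h = h'.
Proof.
move=> Df fh fh'; apply/eqP; rewrite -subr_eq0; apply/eqP.
apply: Hspace_orth_eq0 => [|g Dg].
  by rewrite -[- h']scaleN1r; apply: Hspace_lin; [case: fh|case: fh'].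
rewrite ripDl ripNl.
rewrite -(bform_gframe _ _ _ _ _ Df fh Dg).
by rewrite -(bform_gframe _ _ _ _ _ Df fh' Dg) subrr.
Qed.

(** * The inverse frame operator, the Bessel bound and reconstruction *)

Section LowerSemiFrame.
Variable A : R.
Hypothesis A_gt0 : 0 < A.
Hypothesis xiA : forall f : H, ((A * sqnorm f)%:E <= sum_sq (C f))%E.

(** The Riesz representative of [h] is a preimage, so [gframe_inv] chooses from a nonempty set and
    its default 0 does not intervene. *)
Lemma gframe_invP (h : H) : M h ->
  D (gframe_inv ip xi h) /\ gframe_rel ip xi (gframe_inv ip xi h) h.
Proof.
move=> Mh.
have opP f : gframe_dom ip xi f -> gframe_rel ip xi f (gframe_op ip xi f).
  by move=> [_ ex]; exact: (@xgetPex _ 0 [set h | gframe_rel ip xi f h]).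
suff : gframe_dom ip xi (gframe_inv ip xi h) /\
    gframe_op ip xi (gframe_inv ip xi h) = h.
  by move=> [df dfh]; split; [case: df|rewrite -{2}dfh; exact: opP].
apply: (@xgetPex _ 0 [set f | gframe_dom ip xi f /\ gframe_op ip xi f = h]).
have [f Df fh] := analysis_representation ip ip_norm xi A h A_gt0 xiA.
have rf : gframe_rel ip xi f h := conj Mh (gframe_pairing _ _ _ _ Df fh).
have df : gframe_dom ip xi f by split => //; exists h.
by exists f; split => //; exact: gframe_rel_uniq (opP _ df) rf.
Qed.

Local Notation eta := (fun n => gframe_inv ip xi (orth_proj ip M (xi n))).

Lemma dual_dom n : D (eta n).
Proof. by have [Mp _] := orth_projP (xi n); have [] := gframe_invP _ Mp. Qed.

(** [xi n] and its projection differ by a vector orthogonal to [D(C)], so the projection disappears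
    from the pairing. *)
Lemma bform_dual n (g : H) : D g -> bform ip xi (eta n) g = rip (xi n) g.
Proof.
move=> Dg; have [Mp op] := orth_projP (xi n); have [De rel] := gframe_invP _ Mp.
rewrite (bform_gframe _ _ _ _ _ De rel Dg); apply/eqP; rewrite eq_sym -subr_eq0.
by rewrite -ripNl -ripDl /real_ip op //; exact: analysis_dom_Hspace.
Qed.

(* [u] stands for the preimage of the projection of [f] under the generalised
   frame operator; it turns coefficients against the dual into coefficients
   against [xi]. *)
Lemma dual_coefficients (f : H) : exists u : H,
  [/\ D u, forall g, D g -> bform ip xi u g = rip f g,
      forall n, ip f (eta n) = ip u (xi n) & A * qform ip xi u <= sqnorm f].
Proof.
have [u Du uf] := analysis_representation ip ip_norm xi A f A_gt0 xiA.
exists u; split => // [n|].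
  have De := dual_dom n.
  apply/eqP; rewrite eq_complex !Im_ip; apply/andP; split; apply/eqP.
    by rewrite -/(real_ip _ _ _) -uf // bformC bform_dual // ripC.
  rewrite -uf; last exact: analysis_domZ.
  rewrite -[LHS]opprK -bform_i // bformC bform_dual; last exact: analysis_domZ.
  by rewrite -!Im_ip (ipC _ (xi n)); case: (ip u (xi n)) => a b /=; rewrite opprK.
(* Young's inequality with weight [A]: 2 B(u, u) = 2 Re <f, u> <= |f|^2 / A + A |u|^2, and
   coercivity absorbs the last term into B(u, u). *)
have := rip_le _ ip_norm f u A A_gt0; rewrite -uf // bform_diag //.
have : A * sqnorm u <= qform ip xi u by rewrite -lee_fin /qform -sum_sq_fineK.
move: (sqnorm u) (qform ip xi u) (sqnorm f) => su qu sf h1 h2.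
rewrite mulrC -ler_pdivlMr //; lra.
Qed.

Lemma dual_bessel : bessel_sequence ip eta.
Proof.
exists A^-1; first by rewrite invr_gt0.
move=> f; have [u [Du _ fu uA]] := dual_coefficients f.
have -> : analysis_op ip eta f = C u by apply/funext => n; exact: fu.
by rewrite (sum_sq_fineK _ Du) lee_fin ler_pdivlMl.
Qed.

Lemma real_ip_partial_sum (g d u : H) (s : nat -> nat) (N : nat) :
  (forall n, ip d (eta n) = ip u (xi n)) ->
  rip (\sum_(0 <= j < N) ip g (xi (s j)) *: eta (s j)) d =
  \sum_(0 <= j < N) redot (C g (s j)) (C u (s j)).
Proof.
move=> du; elim: N => [|N IHN]; first by rewrite !big_nil /real_ip linear0l.
rewrite !big_nat_recr //= ripDl IHN; congr (_ + _).
by rewrite /real_ip linearZl_LR /= (ipC _ (gframe_inv _ _ _)) du.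
Qed.

(* The error of a partial sum is controlled, uniformly in the rearrangement, by
   the coefficients it leaves out. *)
Lemma reconstruction_error (g : H) (s : nat -> nat) (N K : nat) (e : R) :
  D g -> injective s ->
  (forall k, (k < K)%N -> exists2 j, (j < N)%N & s j = k) ->
  (forall n, (K <= n)%N -> \sum_(K <= k < n) sqabs (C g k) <= e) ->
  A * sqnorm (g - \sum_(0 <= j < N) ip g (xi (s j)) *: eta (s j)) <= e.
Proof.
move=> Dg s_inj sK tail; set S := \sum_(0 <= j < N) _; set d := g - S.
have [u [Du ud du uA]] := dual_coefficients d.
pose F := [seq s j | j <- index_iota 0 N].
(* [a] keeps the coefficients of [g] that the partial sum leaves out. *)
pose a k : R[i] := if k \in F then 0 else C g k.
have [n0 sn0] := ex_bound s N.
have cvX : (fun n => \sum_(0 <= k < n) redot (a k) (C u k)) @ \oo --> sqnorm d.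
  have -> : sqnorm d = bform ip xi g u
      - \sum_(0 <= j < N) redot (C g (s j)) (C u (s j)).
    rewrite -(real_ip_partial_sum _ _ _ _ _ du) -(rip_sqnorm _ ip_norm).
    by rewrite {1}/d ripDl ripNl (ripC _ g) -ud // bformC.
  set Y := \sum_(0 <= j < N) _.
  have : (fun n => \sum_(0 <= k < n) redot (C g k) (C u k) - Y) @ \oo -->
      bform ip xi g u - Y by apply: cvgB; [exact: cvg_bform|exact: cvg_cst].
  (* From [n0] on, every [s j] with [j < N] is in range, so subtracting [Y] removes exactly the
     terms indexed by [F]. *)
  apply: cvg_trans; apply: near_eq_cvg; exists n0 => // n /= n0n.
  have sn j : (j < N)%N -> (s j < n)%N by move=> /sn0 /leq_trans; apply.
  rewrite /Y (sum_image (fun k => redot (C g k) (C u k)) _ _ _ s_inj sn).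
  rewrite (bigID (fun k => k \in F)) /= addrAC subrr add0r big_mkcond /=.
  apply: eq_bigr => k _; rewrite /a; case: (k \in F) => //=.
  by rewrite /redot mul0r.
(* Indices below [K] all lie in [F], so only the tail contributes. *)
have aE n : (K <= n)%N -> \sum_(0 <= k < n) sqabs (a k) <= e.
  move=> Kn; rewrite (big_cat_nat (n := K)) //= big_nat_cond big1 ?add0r.
    apply: le_trans (tail n Kn); apply: ler_sum => k _.
    rewrite /a; case: (k \in F); rewrite ?lexx //.
    by rewrite sqabsE /= expr0n addr0 sqabs_ge0.
  move=> k /andP[/andP[_ kK] _]; have [j jN sj] := sK k kK.
  by rewrite /a -sj map_f ?mem_index_iota // sqabsE /= expr0n addr0.
have sqd : sqnorm d * sqnorm d <= e * qform ip xi u.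
  set Q := e * _; have cvQ : (fun _ : nat => Q) @ \oo --> Q by exact: cvg_cst.
  have cvX2 : (fun n => (\sum_(0 <= k < n) redot (a k) (C u k)) *
      \sum_(0 <= k < n) redot (a k) (C u k)) @ \oo --> sqnorm d * sqnorm d.
    exact: cvgM.
  apply: ler_cvg_to cvX2 cvQ _; exists K => // n /= Kn.
  rewrite -expr2; apply: le_trans (cauchy_schwarz_sum _ _ _) _.
  apply: ler_pM; rewrite ?aE ?sum_sqabs_le_fine //.
  - by apply: sumr_ge0 => k _; exact: sqabs_ge0.
  - by apply: sumr_ge0 => k _; exact: sqabs_ge0.
have e0 : 0 <= e by have := tail K (leqnn K); rewrite big_geq.
(* A |d|^4 <= e A B(u, u) <= e |d|^2, and a nonzero |d|^2 cancels. *)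
have [d0|d0] := eqVneq (sqnorm d) 0; first by rewrite d0 mulr0.
have dp : 0 < sqnorm d by rewrite lt_neqAle eq_sym d0 sqnorm_ge0.
rewrite -(ler_pM2r dp) -mulrA.
apply: (@le_trans _ _ (A * (e * qform ip xi u))); first by rewrite ler_pM2l.
by rewrite mulrCA ler_wpM2l.
Qed.

Lemma reconstruction (g : H) : D g ->
  unconditionally_sums_to (fun n => ip g (xi n) *: eta n) g.
Proof.
move=> Dg s [s' s'K sK']; apply: cvg_sqr_Re_normP => e e0.
have Ae0 : 0 < A * e / 2 by rewrite divr_gt0 // mulr_gt0.
have /cvgrPdist_lt/(_ _ Ae0)[K _ Ktail] := cvg_qform ip xi _ Dg.
(* [N0] exceeds [s' k] for all [k < K], so the first [N0] rearranged terms include every index below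
   [K]. *)
have [N0 N0P] := ex_bound s' K.
exists N0 => // N /= N0N.
suff : A * sqnorm (g - \sum_(0 <= j < N) ip g (xi (s j)) *: eta (s j)) <= A * e / 2.
  rewrite -mulrA ler_pM2l // => h.
  by apply: le_lt_trans h _; rewrite ltr_pdivrMr // ltr_pMr // ltr1n.
apply: (@reconstruction_error g s N K) => //; first exact: can_inj s'K.
  by move=> k kK; exists (s' k); [exact: leq_trans (N0P k kK) N0N|exact: sK'].
move=> n Kn; have := sum_sqabs_le_fine _ n Dg.
(* The tail is a partial sum, at most [qform g], minus its head, which is within [A * e / 2] of
   [qform g]. *)
have := Ktail K (leqnn K) => /=; rewrite (big_cat_nat (n := K) (p := n)) //=.
rewrite ltr_norml => /andP[_]; rewrite -/(qform ip xi g).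
move: (qform ip xi g) (\sum_(0 <= k < K) _) (\sum_(K <= k < n) _) => *; lra.
Qed.

End LowerSemiFrame.
End DualSequence.

Theorem theorem4p1 (R : realType) (H : completeNormedModType R[i])
    (ip : {dot H for conjC})
    (ip_norm : forall f : H, ip f f = `|f| ^+ 2)
    (H_separable : separable H)
    (xi : nat -> H) (xi_lower : lower_semi_frame ip xi) :
  let P := orth_proj ip (Hspace ip xi) in
  let eta := fun n => gframe_inv ip xi (P (xi n)) in
  bessel_sequence ip eta /\
  (forall g : H, analysis_dom ip xi g ->
     unconditionally_sums_to (fun n => ip g (xi n) *: eta n) g).
Proof.
have [A A_gt0 xiA] := xi_lower; split.
  exact: (dual_bessel ip ip_norm xi A A_gt0 xiA).
exact: (reconstruction ip ip_norm xi A A_gt0 xiA).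
Qed.
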